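(* For all integers $n\ge 1$ and $k\ge 1$ and all $x\in\mathbb{C}$, $$(-1)^n\frac{C_n^{(k)}(x)}{n!}=\sum_{m=1}^{n}\binom{n-1}{n-m}\frac{1}{m!}\widehat{C}_m^{(k)}(x).$$
   Context: $(x)_n = x(x-1)\cdots(x-n+1)$ denotes the falling factorial, with $(x)_0=1$. For integers $k\ge1$, $n\ge0$, the higher-order Cauchy polynomials (of order $k$) of the first and second kind are, respectively, $$C_n^{(k)}(x)=\int_0^1\cdots\int_0^1 (x_1+\cdots+x_k-x)_n\,dx_1\cdots dx_k,$$ $$\widehat{C}_n^{(k)}(x)=\int_0^1\cdots\int_0^1 (x-(x_1+\cdots+x_k))_n\,dx_1\cdots dx_k.$$ *)

(* Defs.v *)
From Stdlib Require Export Reals Factorial.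
From Coquelicot Require Export Coquelicot.

Fixpoint falling (x : C) (n : nat) : C :=
  match n with
  | O => RtoC 1
  | S p => Cmult (falling x p) (Cminus x (RtoC (INR p)))
  end.

Fixpoint Tn_sum (k : nat) : Tn k R -> R :=
  match k with
  | O => fun _ => 0%R
  | S p => fun v => (fst v + Tn_sum p (snd v))%R
  end.

(* The k-fold iterated integral over [0,1]^k.  [RInt] is a total operator; here
   it is only applied to polynomial functions of the real variables, which are
   integrable. *)
Fixpoint cube_RInt (k : nat) : (Tn k R -> C) -> C :=
  match k with
  | O => fun f => f tt
  | S p => fun f =>
      RInt (V := C_R_CompleteNormedModule)
        (fun t : R => cube_RInt p (fun v => f (t, v))) 0 1
  end.

Definition cauchy1 (k n : nat) (x : C) : C :=
  cube_RInt k (fun v => falling (Cminus (RtoC (Tn_sum k v)) x) n).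

Definition cauchy2 (k n : nat) (x : C) : C :=
  cube_RInt k (fun v => falling (Cminus x (RtoC (Tn_sum k v))) n).

(* Main.v *)
Require Import Defs.
From Stdlib Require Import Reals Arith Lia FunctionalExtensionality.
From Coquelicot Require Import Coquelicot.

(** The theorem is the integral over the cube of a pointwise polynomial identity.
    Put [s = x_1 + ... + x_k] and [y = x - s], and write [binom(y, m)] for
    [(y)_m / m!].  Since [(-1)^n (-y)_n = y (y+1) ... (y+n-1) = (y+n-1)_n], the
    integrand on the left is [binom(y+n-1, n)], and Vandermonde's convolution
    expands it as the sum of [C(n-1, n-m) binom(y, m)] over [1 <= m <= n]
    ([rising_over_fact_expansion]).  Vandermonde's convolution itself follows from
    Pascal's rule by induction, once its lower index is allowed a shift
    ([vandermonde_shifted]).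

    To integrate termwise, the integrands must be integrable at every stage of
    the iterated integral.  As they depend on the cube variables only through
    their sum, the iterated integral is the [k]-fold iterate, taken at [0], of the
    operator [window_mean] sending [g] to [s |-> integral of g over [s, s+1]]
    ([cube_RInt_of_sum]).  This operator preserves continuity and is linear on
    continuous functions, so its iterates commute with finite linear
    combinations. *)

(** * Generalized binomial coefficients *)

Definition cbinom (y : C) (n : nat) : C := (falling y n / RtoC (INR (fact n)))%C.

Lemma RtoC_neq_0 (r : R) : r <> 0%R -> RtoC r <> RtoC 0.
Proof. intros hr h; apply hr; exact (RtoC_inj _ _ h). Qed.

Lemma RtoC_INR_S (n : nat) : RtoC (INR (S n)) = (RtoC (INR n) + 1)%C.
Proof. now rewrite S_INR, RtoC_plus. Qed.

Lemma falling_shift (y : C) (n : nat) :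
  falling (y + 1) (S n) = ((y + 1) * falling y n)%C.
Proof.
  induction n as [|n IH].
  - simpl; ring.
  - change (falling (y + 1) (S (S n)))
      with (falling (y + 1) (S n) * (y + 1 - RtoC (INR (S n))))%C.
    rewrite IH, RtoC_INR_S; simpl falling; ring.
Qed.

Lemma cbinom_pascal (y : C) (n : nat) :
  cbinom (y + 1) (S n) = (cbinom y n + cbinom y (S n))%C.
Proof.
  unfold cbinom; rewrite falling_shift; simpl falling.
  rewrite fact_simpl, mult_INR, RtoC_mult, RtoC_INR_S.
  assert (hf := RtoC_neq_0 _ (INR_fact_neq_0 n)).
  assert (hn : (RtoC (INR n) + 1)%C <> RtoC 0).
  { rewrite <- RtoC_INR_S; apply RtoC_neq_0, not_0_INR; discriminate. }
  field; split; assumption.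
Qed.

(** Reading the factors of a rising factorial backwards makes it a falling one. *)
Lemma falling_opp (y : C) (n : nat) :
  (RtoC (-1) ^ n * falling (- y) n)%C = falling (y + RtoC (INR n) - 1) n.
Proof.
  induction n as [|n IH].
  - simpl; ring.
  - replace (y + RtoC (INR (S n)) - 1)%C with (y + RtoC (INR n) - 1 + 1)%C
      by (rewrite RtoC_INR_S; ring).
    rewrite falling_shift, <- IH, Cpow_S.
    change (RtoC (-1)) with (RtoC (- (1))); rewrite RtoC_opp; simpl falling; ring.
Qed.

(** * Vandermonde's convolution *)

(** Pascal's rule for a truncated sum; the boundary term left over at [q = p] is the
    last term of the sum for [p + 1].  Truncating at [q <= p] keeps every
    [Binomial.C i j] within [j <= i], outside which it is not the usual zero. *)
Lemma pascal_sum_truncated (a : nat -> C) (p q : nat) : (q <= p)%nat ->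
  (sum_n (G := C_AbelianMonoid) (fun j => RtoC (Binomial.C p j) * a j) q
   + sum_n (G := C_AbelianMonoid) (fun j => RtoC (Binomial.C p j) * a (S j)) q)%C
  = (sum_n (G := C_AbelianMonoid) (fun j => RtoC (Binomial.C (S p) j) * a j) q
     + RtoC (Binomial.C p q) * a (S q))%C.
Proof.
  induction q as [|q IH]; intros hq.
  - rewrite !sum_O, !C_n_0; ring.
  - rewrite !sum_Sn; change (@plus C_AbelianMonoid) with Cplus.
    specialize (IH (Nat.le_trans _ _ _ (Nat.le_succ_diag_r q) hq)).
    rewrite <- (pascal p q) by lia.
    rewrite RtoC_plus.
    match goal with
    | IH : (?u + ?v = ?w + ?t)%C |- (?u + ?b + (?v + ?c) = _)%C =>
        replace (u + b + (v + c))%C with ((u + v) + (b + c))%C by ring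
    end.
    rewrite IH; ring.
Qed.

Lemma pascal_sum (a : nat -> C) (p : nat) :
  sum_n (G := C_AbelianMonoid) (fun j => RtoC (Binomial.C (S p) j) * a j)%C (S p) =
  (sum_n (G := C_AbelianMonoid) (fun j => RtoC (Binomial.C p j) * a j) p
   + sum_n (G := C_AbelianMonoid) (fun j => RtoC (Binomial.C p j) * a (S j)) p)%C.
Proof.
  rewrite pascal_sum_truncated by lia.
  now rewrite sum_Sn, !C_n_n.
Qed.

(** The shift [r] makes the induction on [p] close: Pascal's rule on [Binomial.C]
    splits the sum into the cases [r] and [r + 1] for [p], and Pascal's rule on
    [cbinom] joins the two results. *)
Lemma vandermonde_shifted (y : C) (p r : nat) :
  sum_n (G := C_AbelianMonoid)
    (fun j => RtoC (Binomial.C p j) * cbinom y (j + r))%C p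
  = cbinom (y + RtoC (INR p)) (p + r).
Proof.
  revert r; induction p as [|p IH]; intros r.
  - rewrite sum_O, C_n_0; simpl.
    replace (y + 0)%C with y by ring; ring.
  - rewrite (pascal_sum (fun j => cbinom y (j + r))), IH.
    rewrite (sum_n_ext _ (fun j => RtoC (Binomial.C p j) * cbinom y (j + S r))%C)
      by (intros j; now rewrite Nat.add_succ_r).
    rewrite IH, Nat.add_succ_r, <- cbinom_pascal, RtoC_INR_S.
    simpl plus; f_equal; ring.
Qed.

Lemma rising_over_fact_expansion (y : C) (p : nat) :
  (RtoC ((-1) ^ S p / INR (fact (S p))) * falling (- y) (S p))%C =
  sum_n (G := C_AbelianMonoid)
    (fun j => RtoC (Binomial.C p j / INR (fact (S j))) * falling y (S j))%C p.
Proof.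
  assert (hinv : forall m, RtoC (/ INR (fact m)) = (/ RtoC (INR (fact m)))%C)
    by (intros m; apply RtoC_inv, INR_fact_neq_0).
  transitivity (cbinom (y + RtoC (INR p)) (p + 1)).
  - rewrite Nat.add_1_r; unfold cbinom, Rdiv.
    replace (y + RtoC (INR p))%C with (y + RtoC (INR (S p)) - 1)%C
      by (rewrite RtoC_INR_S; ring).
    rewrite <- falling_opp, RtoC_mult, hinv, RtoC_pow.
    unfold Cdiv; ring.
  - rewrite <- vandermonde_shifted.
    apply sum_n_ext; intros j.
    rewrite Nat.add_1_r; unfold cbinom, Rdiv, Cdiv.
    rewrite RtoC_mult, hinv.
    match goal with |- ?l = ?r => change (l = r :> C) end; ring.
Qed.

(** * Continuity of complex-valued functions of a real variable *)

Notation Ccontinuous g :=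
  (forall s : R, continuous (T := R_UniformSpace) (U := C_UniformSpace) g s).

Lemma Ccontinuous_pair (u v : R -> R) (s : R) :
  continuous u s -> continuous v s ->
  continuous (T := R_UniformSpace) (U := C_UniformSpace) (fun t => (u t, v t)) s.
Proof.
  intros hu hv.
  apply (continuous_comp_2 (U := R_UniformSpace) (V := R_UniformSpace)
           (W := R_UniformSpace) (X := C_UniformSpace) u v pair s hu hv).
  apply (continuous_ext (fun z : R * R => z)); [now intros []|apply continuous_id].
Qed.

Lemma Ccontinuous_mult (f g : R -> C) :
  Ccontinuous f -> Ccontinuous g -> Ccontinuous (fun s => f s * g s)%C.
Proof.
  intros hf hg s.
  assert (h1 : forall h : R -> C, Ccontinuous h -> continuous (fun t => fst (h t)) s).
  { intros h hh; apply (continuous_comp h fst s (hh s)), continuous_fst. }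
  assert (h2 : forall h : R -> C, Ccontinuous h -> continuous (fun t => snd (h t)) s).
  { intros h hh; apply (continuous_comp h snd s (hh s)), continuous_snd. }
  unfold Cmult; apply Ccontinuous_pair.
  - apply (continuous_minus (V := R_NormedModule));
      apply (continuous_mult (K := R_AbsRing)); auto.
  - apply (continuous_plus (V := R_NormedModule));
      apply (continuous_mult (K := R_AbsRing)); auto.
Qed.

Lemma Ccontinuous_falling (f : R -> C) (n : nat) :
  Ccontinuous f -> Ccontinuous (fun s => falling (f s) n).
Proof.
  intros hf; induction n as [|n IH]; simpl.
  - intros s; apply continuous_const.
  - apply (Ccontinuous_mult (fun s => falling (f s) n)); [exact IH|intros s].
    apply (continuous_minus (V := C_R_NormedModule) f); [apply hf|apply continuous_const].
Qed.

Lemma Ccontinuous_RtoC : Ccontinuous RtoC.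
Proof.
  intros s; apply (Ccontinuous_pair (fun t => t));
    [apply continuous_id|apply continuous_const].
Qed.

(** * The moving average operator *)

Definition window_mean (g : R -> C) (s : R) : C :=
  RInt (V := C_R_CompleteNormedModule) (fun t => g (s + t)%R) 0 1.

Lemma Ccontinuous_ex_RInt (g : R -> C) (a b : R) :
  Ccontinuous g -> ex_RInt (V := C_R_CompleteNormedModule) g a b.
Proof. intros hg; apply ex_RInt_continuous; intros; apply hg. Qed.

Lemma ex_RInt_window (g : R -> C) (s : R) :
  Ccontinuous g ->
  ex_RInt (V := C_R_CompleteNormedModule) (fun t => g (s + t)%R) 0 1.
Proof.
  intros hg; apply Ccontinuous_ex_RInt; intros t.
  apply (continuous_comp (fun t => s + t)%R g); [|apply hg].
  apply (continuous_plus (V := R_NormedModule));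
    [apply continuous_const|apply continuous_id].
Qed.

(** The mean is a difference of two values of the primitive
    [u |-> integral of g over [0, u]], which is differentiable. *)
Lemma Ccontinuous_window_mean (g : R -> C) :
  Ccontinuous g -> Ccontinuous (window_mean g).
Proof.
  intros hg.
  set (G := fun u => RInt (V := C_R_CompleteNormedModule) g 0 u).
  assert (hG : Ccontinuous G).
  { intros s.
    apply (ex_derive_continuous (K := R_AbsRing) (V := C_R_NormedModule)).
    exists (g s).
    apply (is_derive_RInt (V := C_R_NormedModule) g G 0 s); [|apply hg].
    apply filter_forall; intros u.
    apply (RInt_correct (V := C_R_CompleteNormedModule)).
    now apply Ccontinuous_ex_RInt. }
  assert (hmean : forall u : R, (G (u + 1)%R - G u)%C = window_mean g u).
  { intros u; unfold G, window_mean.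
    rewrite <- (RInt_Chasles (V := C_R_CompleteNormedModule) g 0 u (u + 1))
      by now apply Ccontinuous_ex_RInt.
    change (@plus (CompleteNormedModule.AbelianMonoid _ C_R_CompleteNormedModule))
      with Cplus.
    transitivity (RInt (V := C_R_CompleteNormedModule) g u (u + 1)); [ring|].
    assert (h := RInt_comp_lin (V := C_R_CompleteNormedModule) g 1 u 0 1).
    replace (1 * 0 + u)%R with u in h by ring.
    replace (1 * 1 + u)%R with (u + 1)%R in h by ring.
    rewrite <- h by now apply Ccontinuous_ex_RInt.
    f_equal; extensionality t.
    transitivity (g (1 * t + u)%R); [|f_equal; ring].
    exact (scal_one (V := C_R_ModuleSpace) (g (1 * t + u)%R)). }
  intros s; apply (continuous_ext _ _ _ hmean).
  apply (continuous_minus (V := C_R_NormedModule) (fun s => G (s + 1)%R));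
    [|apply hG].
  apply (continuous_comp (fun s => s + 1)%R G); [|apply hG].
  apply (continuous_plus (V := R_NormedModule));
    [apply continuous_id|apply continuous_const].
Qed.

Lemma Ccontinuous_iter_window_mean (k : nat) (g : R -> C) :
  Ccontinuous g -> Ccontinuous (Nat.iter k window_mean g).
Proof.
  intros hg; induction k as [|k IH]; [exact hg|].
  now apply Ccontinuous_window_mean.
Qed.

(** The base point [s] is needed for the induction: each integration variable in
    turn is absorbed into it. *)
Lemma cube_RInt_shifted_sum (k : nat) (g : R -> C) (s : R) :
  cube_RInt k (fun v => g (s + Tn_sum k v)%R) = Nat.iter k window_mean g s.
Proof.
  revert s; induction k as [|k IH]; intros s; simpl.
  - now rewrite Rplus_0_r.
  - unfold window_mean at 1; f_equal; extensionality t.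
    rewrite <- IH; f_equal; extensionality v.
    now rewrite Rplus_assoc.
Qed.

Lemma cube_RInt_of_sum (k : nat) (g : R -> C) :
  cube_RInt k (fun v => g (Tn_sum k v)) = Nat.iter k window_mean g 0%R.
Proof.
  rewrite <- cube_RInt_shifted_sum; f_equal; extensionality v.
  now rewrite Rplus_0_l.
Qed.

Lemma iter_window_mean_scal (k : nat) (a : R) (g : R -> C) : Ccontinuous g ->
  Nat.iter k window_mean (fun s => RtoC a * g s)%C =
  (fun s => RtoC a * Nat.iter k window_mean g s)%C.
Proof.
  intros hg; induction k as [|k IH]; [reflexivity|].
  simpl; rewrite IH; extensionality s; unfold window_mean at 1.
  rewrite <- scal_R_Cmult.
  unfold window_mean at 2.
  rewrite <- (RInt_scal (V := C_R_CompleteNormedModule)).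
  - f_equal; extensionality t; symmetry; apply scal_R_Cmult.
  - apply ex_RInt_window, Ccontinuous_iter_window_mean, hg.
Qed.

Lemma iter_window_mean_plus (k : nat) (f g : R -> C) :
  Ccontinuous f -> Ccontinuous g ->
  Nat.iter k window_mean (fun s => f s + g s)%C =
  (fun s => Nat.iter k window_mean f s + Nat.iter k window_mean g s)%C.
Proof.
  intros hf hg; induction k as [|k IH]; [reflexivity|].
  simpl; rewrite IH; extensionality s.
  apply (RInt_plus (V := C_R_CompleteNormedModule));
    now apply ex_RInt_window, Ccontinuous_iter_window_mean.
Qed.

Lemma Ccontinuous_scal (a : R) (g : R -> C) :
  Ccontinuous g -> Ccontinuous (fun s => RtoC a * g s)%C.
Proof.
  intros hg; apply Ccontinuous_mult; [intros s; apply continuous_const|exact hg].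
Qed.

Lemma Ccontinuous_sum_n (f : nat -> R -> C) (p : nat) :
  (forall j, Ccontinuous (f j)) ->
  Ccontinuous (fun s => sum_n (G := C_AbelianMonoid) (fun j => f j s) p).
Proof.
  intros hf; induction p as [|p IH]; intros s.
  - apply (continuous_ext (f 0%nat)); [|apply hf].
    intros t; now rewrite sum_O.
  - apply (continuous_ext (fun s => plus (G := C_R_NormedModule)
             (sum_n (G := C_AbelianMonoid) (fun j => f j s) p) (f (S p) s))).
    + intros t; now rewrite sum_Sn.
    + apply (continuous_plus (V := C_R_NormedModule)); [apply IH|apply hf].
Qed.

Lemma iter_window_mean_linear_combination
    (k : nat) (b : nat -> R) (f : nat -> R -> C) (p : nat) :
  (forall j, Ccontinuous (f j)) ->
  Nat.iter k window_mean
    (fun s => sum_n (G := C_AbelianMonoid) (fun j => RtoC (b j) * f j s)%C p) =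
  (fun s => sum_n (G := C_AbelianMonoid)
              (fun j => RtoC (b j) * Nat.iter k window_mean (f j) s)%C p).
Proof.
  intros hf; induction p as [|p IH].
  - replace (fun s => sum_n (G := C_AbelianMonoid)
                        (fun j => RtoC (b j) * f j s)%C 0)
      with (fun s => RtoC (b 0%nat) * f 0%nat s)%C
      by (extensionality s; now rewrite sum_O).
    rewrite iter_window_mean_scal by apply hf.
    extensionality s; now rewrite sum_O.
  - replace (fun s => sum_n (G := C_AbelianMonoid)
                        (fun j => RtoC (b j) * f j s)%C (S p))
      with (fun s => sum_n (G := C_AbelianMonoid)
                       (fun j => RtoC (b j) * f j s) p
                     + RtoC (b (S p)) * f (S p) s)%C
      by (extensionality s; now rewrite sum_Sn).
    rewrite (iter_window_mean_plus k
               (fun s => sum_n (G := C_AbelianMonoid)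
                           (fun j => RtoC (b j) * f j s)%C p)).
    + rewrite IH, iter_window_mean_scal by apply hf.
      extensionality s; now rewrite sum_Sn.
    + apply (Ccontinuous_sum_n (fun j s => RtoC (b j) * f j s)%C).
      intros j; apply Ccontinuous_scal, hf.
    + apply Ccontinuous_scal, hf.
Qed.

(** * The identity between the two kinds of Cauchy polynomials *)

Theorem theorem2p9 (n k : nat) (hn : (1 <= n)%nat) (hk : (1 <= k)%nat) (x : C) :
  (RtoC (-1) ^ n * (cauchy1 k n x / RtoC (INR (fact n))))%C =
  sum_n_m (G := C_AbelianMonoid)
    (fun m : nat =>
       (RtoC (Binomial.C (n - 1) (n - m)) * (/ RtoC (INR (fact m)))
          * cauchy2 k m x)%C) 1 n.
Proof.
  destruct n as [|p]; [lia|].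
  set (g1 := fun s : R => falling (RtoC s - x) (S p)).
  set (g2 := fun (j : nat) (s : R) => falling (x - RtoC s) (S j)).
  assert (hg1 : Ccontinuous g1).
  { apply (Ccontinuous_falling (fun s => RtoC s - x)%C); intros s.
    apply (continuous_minus (V := C_R_NormedModule) RtoC);
      [apply Ccontinuous_RtoC|apply continuous_const]. }
  assert (hg2 : forall j, Ccontinuous (g2 j)).
  { intros j; apply (Ccontinuous_falling (fun s => x - RtoC s)%C); intros s.
    apply (continuous_minus (V := C_R_NormedModule) (fun _ => x) RtoC);
      [apply continuous_const|apply Ccontinuous_RtoC]. }
  assert (hinv : forall m, RtoC (/ INR (fact m)) = (/ RtoC (INR (fact m)))%C)
    by (intros m; apply RtoC_inv, INR_fact_neq_0).
  assert (h1 : cauchy1 k (S p) x = Nat.iter k window_mean g1 0%R)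
    by apply (cube_RInt_of_sum k g1).
  assert (h2 : forall j, cauchy2 k (S j) x = Nat.iter k window_mean (g2 j) 0%R)
    by (intros j; apply (cube_RInt_of_sum k (g2 j))).
  set (a := ((-1) ^ S p / INR (fact (S p)))%R).
  set (b := fun j => (Binomial.C p j / INR (fact (S j)))%R).
  transitivity (RtoC a * Nat.iter k window_mean g1 0%R)%C.
  { rewrite h1; unfold a, Rdiv, Cdiv.
    rewrite RtoC_mult, hinv, RtoC_pow; ring. }
  rewrite <- sum_n_m_S; fold (sum_n (G := C_AbelianMonoid)).
  transitivity (sum_n (G := C_AbelianMonoid)
                  (fun j => RtoC (b j) * Nat.iter k window_mean (g2 j) 0%R)%C p).
  - assert (hpt : (fun s => RtoC a * g1 s)%C =
       (fun s => sum_n (G := C_AbelianMonoid) (fun j => RtoC (b j) * g2 j s)%C p)).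
    { extensionality s; unfold g1, g2, a, b.
      rewrite <- rising_over_fact_expansion; do 2 f_equal; ring. }
    apply (f_equal (fun h => Nat.iter k window_mean h 0%R)) in hpt.
    now rewrite iter_window_mean_scal, iter_window_mean_linear_combination in hpt.
  - apply sum_n_ext_loc; intros j hj.
    rewrite h2; unfold b, Rdiv; rewrite RtoC_mult, hinv.
    replace (S p - 1)%nat with p by lia.
    replace (S p - S j)%nat with (p - j)%nat by lia.
    now rewrite <- pascal_step1.
Qed.
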